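(* A class of graphs $\mathcal{X}$ is a function of $\mathcal{L}\cup\mathcal{D}_1$ if and only if there exists $k\in\mathbb{N}$ such that $\mathcal{X}\subseteq\mathcal{D}^*_k\cup\overline{\mathcal{D}^*_k}$.
   Context: All graphs are finite and simple; a class of graphs is a set of graphs closed under isomorphism. $\mathcal{L}$ is the class consisting of all complete graphs and all graphs with exactly two connected components, one of which is a single isolated vertex and the other a complete graph. $\mathcal{D}_1$ is the class of graphs of maximum degree at most 1. For $k\in\mathbb{N}$, $\mathcal{D}^*_k$ is the class of graphs in which all but at most $k$ vertices have degree at most $k$ and the remaining vertices have co-degree at most $k$ (the co-degree of a vertex $v$ in an $n$-vertex graph is $n-1-\deg(v)$); $\overline{\mathcal{D}^*_k}$ is the class of complements of graphs in $\mathcal{D}^*_k$. For a graph $G$ and distinct vertices $u,w$, $G(u,w)=1$ if they are adjacent and $0$ otherwise. If $G,H_1,\dots,H_k$ are graphs on the same vertex set $V$, $G$ is a (boolean) function of $H_1,\dots,H_k$ if there is a boolean function $f:\{0,1\}^k\to\{0,1\}$ with $G(a,b)=f(H_1(a,b),\dots,H_k(a,b))$ for all distinct $a,b\in V$. A class $\mathcal{Y}$ is a $k$-function of $\mathcal{X}$ if every $G\in\mathcal{Y}$ is a function of at most $k$ graphs from $\mathcal{X}$ (on the vertex set of $G$); $\mathcal{Y}$ is a function of $\mathcal{X}$ if it is a $k$-function for some $k\in\mathbb{N}$. *)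

(* Defs.v *)
From mathcomp Require Import all_boot.
Set Implicit Arguments.
Unset Strict Implicit.
Unset Printing Implicit Defensive.

Record sgraph (V : finType) := SGraph {
  edge :> rel V;
  edge_sym : symmetric edge;
  edge_irr : irreflexive edge
}.

Definition complete (V : finType) (G : sgraph V) : Prop :=
  forall x y : V, x != y -> G x y.

Definition clique (V : finType) (G : sgraph V) (B : {set V}) : Prop :=
  {in B &, forall x y : V, x != y -> G x y}.

Definition components (V : finType) (G : sgraph V) : {set {set V}} :=
  equivalence_partition (connect G) [set: V].

Definition degree (V : finType) (G : sgraph V) (v : V) : nat :=
  #|[set w | G v w]|.

Definition max_degree (V : finType) (G : sgraph V) : nat :=
  \max_(v : V) degree G v.

Definition codegree (V : finType) (G : sgraph V) (v : V) : nat :=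
  #|V| - 1 - degree G v.

Definition compl_rel (V : finType) (G : sgraph V) : rel V :=
  fun x y => (x != y) && ~~ G x y.

Lemma compl_sym (V : finType) (G : sgraph V) : symmetric (compl_rel G).
Proof. by move=> x y; rewrite /compl_rel eq_sym edge_sym. Qed.

Lemma compl_irr (V : finType) (G : sgraph V) : irreflexive (compl_rel G).
Proof. by move=> x; rewrite /compl_rel eqxx. Qed.

Definition compl (V : finType) (G : sgraph V) : sgraph V :=
  SGraph (compl_sym G) (compl_irr G).

Definition isomorphic (V W : finType) (G : sgraph V) (H : sgraph W) : Prop :=
  exists2 f : V -> W, bijective f & forall x y : V, H (f x) (f y) = G x y.

Definition graph_set := forall V : finType, sgraph V -> Prop.

(* A class of graphs is an X : graph_set such that iso_closed X. *)
Definition iso_closed (X : graph_set) : Prop :=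
  forall (V W : finType) (G : sgraph V) (H : sgraph W),
    isomorphic G H -> X V G -> X W H.

Definition class_union (X Y : graph_set) : graph_set :=
  fun V G => X V G \/ Y V G.

Definition class_sub (X Y : graph_set) : Prop :=
  forall (V : finType) (G : sgraph V), X V G -> Y V G.

(* Graphs are compared through their edge relations, as Leibniz equality of
   sgraphs is not extensional. *)
Definition class_compl (X : graph_set) : graph_set :=
  fun V G => exists2 H : sgraph V, X V H & G =2 compl H.

Definition class_L : graph_set := fun V G =>
  complete G \/
  exists (v : V) (B : {set V}),
    [/\ B != [set v], components G = [set [set v]; B] & clique G B].

Definition class_D1 : graph_set := fun V G => max_degree G <= 1.

Definition class_Dstar (k : nat) : graph_set := fun V G =>
  exists S : {set V},
    [/\ #|S| <= k,
        forall v, v \notin S -> degree G v <= k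
      & forall v, v \in S -> codegree G v <= k].

Definition boolean_function_of (V : finType) (G : sgraph V) (j : nat)
    (H : 'I_j -> sgraph V) : Prop :=
  exists f : j.-tuple bool -> bool,
    forall a b : V, a != b -> G a b = f [tuple H i a b | i < j].

Definition k_function (k : nat) (Y X : graph_set) : Prop :=
  forall (V : finType) (G : sgraph V), Y V G ->
    exists (j : nat) (H : 'I_j -> sgraph V),
      [/\ j <= k, forall i, X V (H i) & boolean_function_of G H].

Definition function_of (Y X : graph_set) : Prop :=
  exists k : nat, k_function k Y X.

(* Main.v *)
Require Import Defs.
From mathcomp Require Import all_boot.
Set Implicit Arguments.
Unset Strict Implicit.
Unset Printing Implicit Defensive.

(** Call a graph m-homogeneous when, for some colour [c] and some guess [t] of
    each row of its adjacency matrix by a constant, at most m rows have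
    [t a != c] and each row differs from its guess in at most m off-diagonal
    entries.  Up to complementation this is exactly membership in D*_m.
    Members of L and of D_1 are 1-homogeneous, and a boolean function of j
    1-homogeneous graphs is j-homogeneous, the guesses being combined by the
    same function.  Conversely, let S be the set of exceptional rows of an
    m-homogeneous graph.  Flipping all pairs that meet S (a function of |S|
    members of L) leaves, up to complementation, a graph of maximum degree at
    most 2m, whose edges are properly coloured greedily by 4m+1 matchings. *)

(** * Homogeneity and membership in $\mathcal{D}^*_m$ up to complement *)

Definition row_defect (V : finType) (G : sgraph V) (t : V -> bool) (a : V) :
  {set V} := [set b | (b != a) && (G a b != t a)].

Definition homogeneous (m : nat) : graph_set := fun V G =>
  exists (t : {ffun V -> bool}) (c : bool),
    #|[set a | t a != c]| <= m /\ forall a, #|row_defect G t a| <= m.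

Lemma homogeneousW (m n : nat) (V : finType) (G : sgraph V) :
  m <= n -> homogeneous m G -> homogeneous n G.
Proof.
move=> le_mn [t [c [ht hd]]]; exists t, c; split; first exact: leq_trans le_mn.
by move=> a; apply: leq_trans (hd a) le_mn.
Qed.

Lemma degree_row_defect (V : finType) (G : sgraph V) (t : V -> bool) (a : V) :
  t a = false -> degree G a = #|row_defect G t a|.
Proof.
move=> ta; apply: eq_card => b; rewrite !inE ta eqbF_neg negbK.
by case: eqP => // ->; rewrite edge_irr.
Qed.

Lemma codegree_row_defect (V : finType) (G : sgraph V) (t : V -> bool) (a : V) :
  t a = true -> codegree G a = #|row_defect G t a|.
Proof.
move=> ta; rewrite /codegree /degree.
have -> : row_defect G t a = [set~ a] :\: [set w | G a w].
  by apply/setP => b; rewrite !inE ta eqb_id andbC.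
rewrite cardsD cardsC1 subn1; congr (_ - _); apply: eq_card => b; rewrite !inE.
by case: eqP => // ->; rewrite edge_irr.
Qed.

(** The exceptional set of $\mathcal{D}^*_m$ is the set of rows guessed [true]: the degree counts
    the defects of the guess [false], the co-degree those of the guess [true]. *)
Lemma Dstar_homogeneous (m : nat) (V : finType) (G : sgraph V) :
  class_Dstar m G <->
  exists t : {ffun V -> bool},
    #|[set a | t a]| <= m /\ forall a, #|row_defect G t a| <= m.
Proof.
split=> [[S [hS hlow hhigh]] | [t [ht hd]]].
  exists [ffun a => a \in S]; split.
    by rewrite (_ : [set a | _] = S) //; apply/setP => a; rewrite inE ffunE.
  move=> a; case aS: (a \in S).
    by rewrite -codegree_row_defect ?ffunE // hhigh.
  by rewrite -degree_row_defect ?ffunE // hlow // aS.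
exists [set a | t a]; split=> // v; rewrite inE.
  by move/negbTE=> tv; rewrite (degree_row_defect _ tv).
by move=> tv; rewrite (codegree_row_defect _ tv).
Qed.

Lemma row_defect_compl (V : finType) (G H : sgraph V) (t u : V -> bool) (a : V) :
  G =2 compl H -> u a = ~~ t a -> row_defect G u a = row_defect H t a.
Proof.
move=> GH ua; apply/setP => b; rewrite !inE GH ua /= /compl_rel.
by rewrite (eq_sym a); case: (b != a); case: (H a b); case: (t a).
Qed.

(** The colour [c] selects the side of the union: with [false] the graph itself lies in
    $\mathcal{D}^*_m$, with [true] its complement does, by negating all guesses. *)
Lemma homogeneousP (m : nat) (V : finType) (G : sgraph V) :
  class_union (class_Dstar m) (class_compl (class_Dstar m)) G <->
  homogeneous m G.
Proof.
split.
  case=> [/Dstar_homogeneous [t [ht hd]] | [H /Dstar_homogeneous [t [ht hd]] GH]].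
    exists t, false; split=> //.
    by rewrite (_ : [set a | _] = [set a | t a]) //; apply/setP => a;
      rewrite !inE; case: (t a).
  exists [ffun a => ~~ t a], true; split.
    by rewrite (_ : [set a | _] = [set a | t a]) //; apply/setP => a;
      rewrite !inE ffunE; case: (t a).
  by move=> a; rewrite (@row_defect_compl V G H t) ?ffunE.
case=> t [[] [ht hd]].
  right; exists (compl G).
    apply/Dstar_homogeneous; exists [ffun a => ~~ t a]; split.
      rewrite (_ : [set a | _] = [set a | t a != true]) //; apply/setP => a.
      by rewrite !inE ffunE; case: (t a).
    by move=> a; rewrite (@row_defect_compl V _ G t) ?ffunE.
  move=> x y /=; rewrite /compl_rel /= /compl_rel.
  by case: eqP => [->|] /=; rewrite ?edge_irr ?negbK.
left; apply/Dstar_homogeneous; exists t; split=> //.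
rewrite (_ : [set a | _] = [set a | t a != false]) //; apply/setP => a.
by rewrite !inE; case: (t a).
Qed.

(** * Boolean functions of members of $\mathcal{L}\cup\mathcal{D}_1$ are homogeneous *)

Lemma isolated_vertex_clique (V : finType) (G : sgraph V) (v : V) (B : {set V}) :
  components G = [set [set v]; B] -> clique G B ->
  forall a b, a != b -> G a b = (a != v) && (b != v).
Proof.
move=> compG cliqueB.
have class_mem z : [set y | connect G z y] \in components G.
  apply/imsetP; exists z; rewrite ?inE //.
  by apply/setP => y; rewrite !inE.
have v_isolated b : G v b -> b = v.
  move=> Gvb.
  have /imsetP [z _ Ez] : [set v] \in components G by rewrite compG !inE eqxx.
  have : z \in [set v] by rewrite Ez !inE connect0.
  rewrite inE => /eqP zv; apply/eqP; rewrite -in_set1 Ez !inE zv.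
  exact: connect1.
have in_B x : x != v -> x \in B.
  move=> xv; have := class_mem x; rewrite compG !inE => /orP [] /eqP Ex.
    have : x \in [set v] by rewrite -Ex inE connect0.
    by rewrite inE (negbTE xv).
  by rewrite -Ex inE connect0.
move=> a b ab; case: eqP => [av | /eqP av] /=.
  by apply/negP; rewrite av => /v_isolated bv; rewrite av bv eqxx in ab.
case: eqP => [bv | /eqP bv] /=; last by apply: cliqueB => //; apply: in_B.
by apply/negP; rewrite bv edge_sym => /v_isolated av'; rewrite av' eqxx in av.
Qed.

Lemma generators_homogeneous (V : finType) (G : sgraph V) :
  class_union class_L class_D1 G -> homogeneous 1 G.
Proof.
case=> [[complG | [v [B [_ compG cliqueB]]]] | degG].
- exists [ffun=> true], true; split.
    by rewrite eq_card0 // => a; rewrite !inE ffunE.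
  move=> a; rewrite eq_card0 // => b; rewrite !inE ffunE eq_sym.
  by case ab: (a == b) => //=; rewrite complG ?ab.
(* The isolated vertex [v] is the only exceptional row, and also the only possible defect of every
   other row. *)
- exists [ffun a => a != v], true; split.
    rewrite -(cards1 v); apply: subset_leq_card; apply/subsetP => a.
    by rewrite !inE ffunE eqb_id negbK.
  move=> a; rewrite -(cards1 v); apply: subset_leq_card; apply/subsetP => b.
  rewrite !inE ffunE => /andP [ba].
  rewrite (isolated_vertex_clique compG cliqueB) 1?eq_sym //.
  by case: (a == v); case: (b == v).
exists [ffun=> false], false; split.
  by rewrite eq_card0 // => a; rewrite !inE ffunE.
move=> a; rewrite -degree_row_defect ?ffunE //; apply: leq_trans degG.
exact: (leq_bigmax (F := degree G) a).
Qed.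

Lemma card_bigcup_le1 (I V : finType) (F : I -> {set V}) :
  (forall i, #|F i| <= 1) -> #|\bigcup_i F i| <= #|I|.
Proof.
move=> F1; rewrite -[#|I|]sum1_card (eq_bigl xpredT) //.
apply: (big_ind2 (fun (A : {set V}) n => #|A| <= n)) => [|A m B n hA hB|i _].
- by rewrite cards0.
- by apply: leq_trans (leq_card_setU A B) (leq_add hA hB).
- exact: F1.
Qed.

(** If row [a] is exceptional in no [H i], then [f] receives the same tuple for the guess as for the
    colour. So the exceptional rows of [G] lie in a union of [j] sets of size at most one; defects
    within a row are bounded in the same way. *)
Lemma boolean_function_homogeneous (V : finType) (G : sgraph V) (j : nat)
    (H : 'I_j -> sgraph V) :
  (forall i, homogeneous 1 (H i)) -> boolean_function_of G H ->
  homogeneous j G.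
Proof.
move=> /fin_all_exists [t] /fin_all_exists [c hH] [f Gf].
exists [ffun a => f [tuple t i a | i < j]], (f [tuple c i | i < j]); split.
  rewrite -[j in _ <= j]card_ord.
  apply: leq_trans (card_bigcup_le1 (fun i => (hH i).1)).
  apply: subset_leq_card; apply/subsetP => a; rewrite !inE ffunE => neq.
  apply: contraNT neq => none.
  apply/eqP; congr f; apply: eq_from_tnth => i; rewrite !tnth_mktuple.
  by apply/eqP; apply: contraNT none => neq; apply/bigcupP; exists i; rewrite ?inE.
move=> a; rewrite -[j in _ <= j]card_ord.
apply: leq_trans (card_bigcup_le1 (fun i => (hH i).2 a)).
apply: subset_leq_card; apply/subsetP => b; rewrite !inE ffunE => /andP [ba neq].
apply: contraNT neq => none.
rewrite (Gf a b); last by rewrite eq_sym.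
apply/eqP; congr f; apply: eq_from_tnth => i; rewrite !tnth_mktuple.
by apply/eqP; apply: contraNT none => neq; apply/bigcupP; exists i; rewrite ?inE ?ba.
Qed.

(** * Decomposition into matchings by greedy edge colouring *)

Lemma greedy_coloring (T : finType) (e : rel T) (d : nat) :
  symmetric e -> (forall x, #|[set y | e x y]| <= d) ->
  exists c : T -> 'I_d.+1, forall x y, x != y -> e x y -> c x != c y.
Proof.
move=> e_sym deg_e.
have [c hc] : exists c : T -> 'I_d.+1, {in enum T &, forall x y,
    x != y -> e x y -> c x != c y}.
  elim: (enum T) => [|z s [c hc]]; first by exists (fun=> ord0).
  (* The at most [d] neighbours of [z], whether or not they are in [s], leave one of the [d.+1]
     colours free for [z]. *)
  have : ~~ ([set: 'I_d.+1] \subset c @: [set y | e z y]).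
    apply/negP => /subset_leq_card; rewrite cardsT card_ord => le_d.
    have := leq_trans le_d (leq_trans (leq_imset_card _ _) (deg_e z)).
    by rewrite ltnn.
  case/subsetPn => i _ fresh.
  have new y : e z y -> i != c y.
    by move=> ezy; apply: contraNneq fresh => ->; rewrite imset_f ?inE.
  exists (fun x => if x == z then i else c x) => x y.
  rewrite !inE => xs ys xy exy.
  case: (eqVneq x z) xs xy exy => [-> _ zy ezy | xz /= xs xy exy].
    by rewrite (eq_sym y) (negbTE zy); apply: new.
  case: (eqVneq y z) ys exy => [-> _ exz | yz /= ys exy]; last exact: hc.
  by rewrite eq_sym new // e_sym.
by exists c => x y; apply: hc; rewrite mem_enum.
Qed.

Definition color_class_rel (V : finType) (G : sgraph V) (n : nat)
    (c : {set V} -> 'I_n) (i : 'I_n) : rel V :=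
  fun a b => G a b && (c [set a; b] == i).

Lemma color_class_sym (V : finType) (G : sgraph V) (n : nat)
    (c : {set V} -> 'I_n) (i : 'I_n) : symmetric (color_class_rel G c i).
Proof. by move=> a b; rewrite /color_class_rel edge_sym setUC. Qed.

Lemma color_class_irr (V : finType) (G : sgraph V) (n : nat)
    (c : {set V} -> 'I_n) (i : 'I_n) : irreflexive (color_class_rel G c i).
Proof. by move=> a; rewrite /color_class_rel edge_irr. Qed.

Definition color_class (V : finType) (G : sgraph V) (n : nat)
    (c : {set V} -> 'I_n) (i : 'I_n) : sgraph V :=
  SGraph (color_class_sym G c i) (color_class_irr G c i).

Lemma matching_decomposition (V : finType) (G : sgraph V) (d : nat) :
  (forall a, degree G a <= d) ->
  exists M : 'I_(d + d).+1 -> sgraph V,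
    (forall i, class_D1 (M i)) /\ forall a b, G a b = [exists i, M i a b].
Proof.
move=> deg_G.
(* Edges are coloured as vertices of the line graph [e], extended to all subsets of [V]. An edge is
   related to itself, and a set that is not an edge is related to nothing. *)
pose inc (a : V) := [set [set a; w] | w in [set w | G a w]].
pose e (A B : {set V}) := [exists x, (A \in inc x) && (B \in inc x)].
have e_sym : symmetric e.
  by move=> A B; apply: eq_existsb => x; rewrite andbC.
have deg_e A : #|[set B | e A B]| <= d + d.
  have inc_le x : #|inc x| <= d by exact: leq_trans (leq_imset_card _ _) (deg_G x).
  (* Whatever meets the edge [A] = {x, w} is incident to [x] or to [w], which gives the bound
     [d + d]. *)
  case: (pickP (fun x => A \in inc x)) => [x /imsetP [w _ EA] | noA].
    apply: leq_trans (leq_add (inc_le x) (inc_le w)).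
    apply: leq_trans (leq_card_setU _ _).
    apply: subset_leq_card; apply/subsetP => B; rewrite !inE.
    case/existsP => z /andP [/imsetP [u _ EA'] Bz].
    have : z \in A by rewrite EA' !inE eqxx.
    by rewrite EA !inE => /orP [] /eqP <-; rewrite Bz ?orbT.
  rewrite eq_card0 // => B; rewrite inE; apply/existsP => [[x]].
  by rewrite (noA x).
have [c hc] := greedy_coloring e_sym deg_e.
exists (color_class G c); split=> [i | a b].
  apply/bigmax_leqP => a _; rewrite leqNgt; apply/negP.
  case/card_gt1P => x [y []]; rewrite !inE => /andP [Gax cx] /andP [Gay cy] xy.
  have neq : [set a; x] != [set a; y].
    apply: contraNneq xy => E.
    have : x \in [set a; y] by rewrite -E !inE eqxx orbT.
    by rewrite !inE => /orP [] // /eqP xa; rewrite xa edge_irr in Gax.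
  have eaxy : e [set a; x] [set a; y].
    by apply/existsP; exists a; apply/andP; split; apply: imset_f; rewrite inE.
  by move: (hc _ _ neq eaxy); rewrite (eqP cx) (eqP cy) eqxx.
apply/idP/existsP => [Gab | [i /andP []] //].
by exists (c [set a; b]); rewrite /= /color_class_rel Gab eqxx.
Qed.

(** * Recovering a homogeneous graph from generators *)

Definition isolate_rel (V : finType) (v : V) : rel V :=
  fun a b => [&& a != b, a != v & b != v].

Lemma isolate_sym (V : finType) (v : V) : symmetric (isolate_rel v).
Proof. by move=> a b; rewrite /isolate_rel eq_sym (andbC (a != v)). Qed.

Lemma isolate_irr (V : finType) (v : V) : irreflexive (isolate_rel v).
Proof. by move=> a; rewrite /isolate_rel eqxx. Qed.

Definition isolate (V : finType) (v : V) : sgraph V :=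
  SGraph (isolate_sym v) (isolate_irr v).

Lemma isolate_in_L (V : finType) (v : V) : class_L (isolate v).
Proof.
(* If [v] is the only vertex, there is no second component, but the graph is complete; otherwise [w]
   represents the second component. *)
case: (set_0Vmem [set~ v]) => [V1 | [w]].
  have all_v x : x = v.
    by apply/eqP; have := in_set0 x; rewrite -V1 !inE => /negbFE.
  by left=> x y; rewrite (all_v x) (all_v y) eqxx.
rewrite !inE => wv; right; exists v, [set~ v]; split.
- by apply/eqP => /setP /(_ v); rewrite !inE eqxx.
- have closed_v : closed (isolate v) [set v].
    by move=> a b /and3P [_ av bv]; rewrite !inE (negbTE av) (negbTE bv).
  have class_of z : [set y in [set: V] | connect (isolate v) z y] =
      if z == v then [set v] else [set~ v].
    apply/setP => y; rewrite !inE /=; case: (eqVneq z v) => [-> | zv].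
      rewrite inE; apply/idP/eqP => [vy | ->]; last exact: connect0.
      by have := closed_connect closed_v vy; rewrite !inE eqxx => /esym/eqP.
    rewrite !inE; apply/idP/idP => [zy | yv].
      by have := closed_connect closed_v zy; rewrite !inE (negbTE zv) => <-.
    case: (eqVneq z y) => [-> | zy]; first exact: connect0.
    by apply: connect1; rewrite /= /isolate_rel zy zv.
  apply/setP => A; rewrite !inE; apply/imsetP/orP => [[z _ ->] | [] /eqP ->].
  + by rewrite class_of; case: ifP => _; rewrite eqxx; [left | right].
  + by exists v; rewrite ?inE // class_of eqxx.
  + by exists w; rewrite ?inE // class_of (negbTE wv).
- by move=> x y; rewrite !inE => xv yv xy; rewrite /= /isolate_rel xy xv.
Qed.

(** Off the diagonal this is a sum modulo 2: the pairs meeting [S] are flipped, and the result is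
    complemented when [c] is [true]. *)
Definition flip_rel (V : finType) (G : sgraph V) (S : {set V}) (c : bool) :
  rel V := fun a b => (a != b) && (G a b != c (+) ((a \in S) || (b \in S))).

Lemma flip_sym (V : finType) (G : sgraph V) (S : {set V}) (c : bool) :
  symmetric (flip_rel G S c).
Proof. by move=> a b; rewrite /flip_rel eq_sym edge_sym (orbC (a \in S)). Qed.

Lemma flip_irr (V : finType) (G : sgraph V) (S : {set V}) (c : bool) :
  irreflexive (flip_rel G S c).
Proof. by move=> a; rewrite /flip_rel eqxx. Qed.

Definition flip (V : finType) (G : sgraph V) (S : {set V}) (c : bool) :
  sgraph V := SGraph (flip_sym G S c) (flip_irr G S c).

Lemma homogeneous_function (m : nat) (V : finType) (G : sgraph V) :
  homogeneous m G ->
  exists (j : nat) (H : 'I_j -> sgraph V),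
    [/\ j <= m + (m + m + (m + m)).+1,
        forall i, class_union class_L class_D1 (H i)
      & boolean_function_of G H].
Proof.
case=> t [c []]; set S := [set a | t a != c] => hS hd.
(* If [b] is not a defect of row [a], then [G a b] is [t a], which equals the value subtracted by
   the flip unless [a] is outside [S] and [b] inside. So every neighbour of [a] is a defect or lies
   in [S]. *)
have deg_flip a : degree (flip G S c) a <= m + m.
  apply: leq_trans (leq_add (hd a) hS); apply: leq_trans (leq_card_setU _ _).
  apply: subset_leq_card; apply/subsetP => b; rewrite !inE /= /flip_rel !inE.
  rewrite eq_sym => /andP [->] /=.
  by case: (G a b) (t a) (t b) (c) => [] [] [] [].
have [M [M_D1 flipE]] := matching_decomposition deg_flip.
pose H (i : 'I_(#|S| + (m + m + (m + m)).+1)) :=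
  match split i with inl s => isolate (enum_val s) | inr l => M l end.
exists _, H; split.
- by rewrite leq_add2r.
- move=> i; rewrite /H; case: (split i) => s; last by right; apply: M_D1.
  by left; apply: isolate_in_L.
(* The flip is undone: a pair meets [S] exactly when it is a non-edge of some isolating graph, and
   it is an edge of the flipped graph exactly when some matching contains it. *)
exists (fun u => c (+) [exists s, ~~ tnth u (lshift _ s)]
                   (+) [exists l, tnth u (rshift _ l)]) => a b ab.
have -> : [exists s, ~~ tnth [tuple H i a b | i < _] (lshift _ s)]
          = (a \in S) || (b \in S).
  apply/existsP/idP => [[s] | abS].
    rewrite tnth_mktuple /H (unsplitK (inl s)) /= /isolate_rel ab /=.
    rewrite negb_and !negbK => /orP [] /eqP ->; rewrite enum_valP ?orbT //.
  have [v vS vab] : exists2 v, v \in S & (a == v) || (b == v).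
    by case/orP: abS; [exists a | exists b]; rewrite ?eqxx ?orbT.
  exists (enum_rank_in vS v).
  rewrite tnth_mktuple /H (unsplitK (inl _)) /= enum_rankK_in //.
  by rewrite /isolate_rel ab -negb_or negbK.
have -> : [exists l, tnth [tuple H i a b | i < _] (rshift _ l)] = flip G S c a b.
  rewrite flipE; apply: eq_existsb => l.
  by rewrite tnth_mktuple /H (unsplitK (inr l)).
rewrite /= /flip_rel ab /=.
by case: (G a b) (c) (_ || _) => [] [] [].
Qed.

Theorem theorem4p14 (X : graph_set) (X_class : iso_closed X) :
  function_of X (class_union class_L class_D1) <->
  exists k : nat,
    class_sub X (class_union (class_Dstar k) (class_compl (class_Dstar k))).
Proof.
split=> [[k Xk] | [k Xk]].
  exists k => V G /Xk [j [H [jk HX GH]]]; apply/homogeneousP.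
  apply: homogeneousW jk _; apply: boolean_function_homogeneous GH.
  by move=> i; apply/generators_homogeneous/HX.
exists (k + (k + k + (k + k)).+1) => V G /Xk /homogeneousP.
exact: homogeneous_function.
Qed.
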